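(* For a point cloud $\nu=\{\nu_1,\dots,\nu_n\}\subset\mathbb{R}$ let $\mathrm{diam}(\nu)=\max_j\nu_j-\min_j\nu_j$, and for $0\le\eta\le\mathrm{diam}(\nu)$ let $$\rho(\nu,\eta)=\frac{|\{j:\nu_j\ge\max_i\nu_i-\eta\}|}{n}.$$ Given a sequence of point clouds $\nu^n=\{\nu^n_1,\dots,\nu^n_n\}$, $n\ge1$, set $$\alpha=\liminf_n\ \sup_{0\le\eta\le\mathrm{diam}(\nu^n)}\frac{\sqrt{\rho(\nu^n,\eta)}-\eta}{2},\qquad\beta=\limsup_n\ \mathrm{diam}(\nu^n)+2.$$ If $\alpha>0$ and $\beta<\infty$ then $\nu^n\in F(\alpha,\beta)$ for all sufficiently large $n$.
   Context: A point cloud is a finite collection of real points counted with multiplicity. For $\nu=\{\nu_1,\dots,\nu_n\}$, $b(\nu)>\max_j\nu_j$ is the unique real number with $1=\frac1n\sum_{j=1}^n\frac{1}{(b(\nu)-\nu_j)^2}$. For $0<\alpha\le\beta<\infty$, $F(\alpha,\beta)$ is the set of point clouds $\nu=\{\nu_1,\dots,\nu_n\}$ (for some $n$) with $\alpha\le b(\nu)-\nu_j\le\beta$ for all $1\le j\le n$. *)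

(* Defs.v *)
From HB Require Import structures.
From mathcomp Require Import all_boot all_order all_algebra.
From mathcomp Require Import all_classical all_reals all_analysis.

Set Implicit Arguments.
Unset Strict Implicit.
Unset Printing Implicit Defensive.

Import Order.TTheory GRing.Theory Num.Theory.
Import numFieldNormedType.Exports.

Local Open Scope classical_set_scope.
Local Open Scope ring_scope.

(* A point cloud is a sequence of reals, i.e. its points listed with
   multiplicity; every notion below is invariant under permutation. *)
Definition point_cloud (R : realType) := seq R.

Section PointCloud.
Variable R : realType.
Implicit Types nu : point_cloud R.

(* The default value is a point of the cloud, so for a nonempty cloud these
   are the true maximum and minimum. *)
Definition cloud_max nu : R := \big[Num.max/head 0 nu]_(x <- nu) x.
Definition cloud_min nu : R := \big[Num.min/head 0 nu]_(x <- nu) x.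

Definition diam nu : R := cloud_max nu - cloud_min nu.

Definition rho nu (eta : R) : R :=
  (count (fun x => cloud_max nu - eta <= x) nu)%:R / (size nu)%:R.

(* For a nonempty cloud exactly one real satisfies the defining property,
   since t |-> n^-1 \sum_j (t - nu_j)^-2 decreases strictly from +oo to 0
   on the half-line above the maximum. *)
Definition cloud_b nu : R :=
  get [set t : R | cloud_max nu < t /\
                   1 = (size nu)%:R^-1 * \sum_(x <- nu) 1 / (t - x) ^+ 2].

(* Extended bounds, so that a liminf or a limsup can be used directly as a
   bound; the intended range is 0 < alpha <= beta < +oo. *)
Definition cloud_F (alpha beta : \bar R) : set (point_cloud R) :=
  [set nu | nu != [::] /\
     forall x, x \in nu -> (alpha <= (cloud_b nu - x)%:E <= beta)%E].

End PointCloud.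

(* Main.v *)
Require Import Defs.
From HB Require Import structures.
From mathcomp Require Import all_boot all_order all_algebra.
From mathcomp Require Import all_classical all_reals all_analysis.
From mathcomp Require Import lra.

(** Write [M] for the maximum of a nonempty cloud, [d] for its diameter and
    [b] for [cloud_b]. Both bounds come from the equation defining [b], which
    says that the mean of the numbers [1 / (b - x) ^+ 2] is [1].

    - A mean is at most its largest term, here [1 / (b - M) ^+ 2]; hence
      [b - M <= 1] ([cloud_b_sub_max_le1]), and every gap [b - x] is at most
      [d + 1].
    - A proportion [rho eta] of the terms is at least [1 / (b - M + eta) ^+ 2],
      so [rho eta <= (b - M + eta) ^+ 2] by a Markov-type count; hence
      [sqrt (rho eta) - eta <= b - M] ([sqrt_rho_sub_le]), and every gap is at
      least twice the supremum appearing in the definition of [alpha].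

    Each of these is better than what is required: the factor [2] in the lower
    bound and the difference between [d + 1] and [d + 2] in the upper one leave
    room to pass to the limit. Since [0 < alpha], the supremum eventually
    exceeds [alpha / 2], and [d] is eventually below its limsup plus [1]
    ([lt_limn_einf_near], [limn_esup_lt_near]). The bound [b - M <= 1] also
    excludes [alpha = +oo].

    As [cloud_b] is a choice, its defining equation holds only once a solution
    is known to exist ([cloud_b_exists]). *)

Set Implicit Arguments.
Unset Strict Implicit.
Unset Printing Implicit Defensive.

Import Order.TTheory GRing.Theory Num.Theory.
Import numFieldNormedType.Exports.

Local Open Scope classical_set_scope.
Local Open Scope ring_scope.

Lemma limn_esup_lt_near (R : realType) (u : nat -> \bar R) (y : \bar R) :
  (limn_esup u < y)%E -> \forall n \near \oo, (u n < y)%E.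
Proof.
move=> /ereal_inf_lt[_ [V FV <-] supV].
apply: filterS FV => n Vn; apply: le_lt_trans supV.
by apply: ereal_sup_ubound; exists n.
Qed.

Lemma lt_limn_einf_near (R : realType) (u : nat -> \bar R) (y : \bar R) :
  (y < limn_einf u)%E -> \forall n \near \oo, (y < u n)%E.
Proof.
rewrite /limn_einf lteNr => /limn_esup_lt_near.
by apply: filterS => n; rewrite lteN2.
Qed.

(** Markov's inequality for a finite sum. *)
Lemma count_mul_le_sum (R : realDomainType) (I : eqType) (s : seq I)
    (P : pred I) (f : I -> R) (c : R) :
  {in s, forall x, 0 <= f x} -> {in s, forall x, P x -> c <= f x} ->
  (count P s)%:R * c <= \sum_(x <- s) f x.
Proof.
move=> f0 cf.
rewrite -sum1_count natr_sum mulr_suml (big_mkcond P) /=.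
rewrite big_seq [leRHS]big_seq; apply: ler_sum => x xs.
by case: ifPn => [/(cf _ xs)|_]; rewrite ?mul1r// f0.
Qed.

Section Cloud.
Variable R : realType.
Implicit Types (nu : point_cloud R) (t x eta : R).

Lemma le_cloud_max nu x : x \in nu -> x <= cloud_max nu.
Proof. by move=> xnu; exact: (@le_bigmax_seq _ _ _ _ _ _ _ id). Qed.

Lemma cloud_min_le nu x : x \in nu -> cloud_min nu <= x.
Proof. by move=> xnu; exact: (@ge_bigmin_seq _ _ _ _ _ _ _ id). Qed.

Lemma cloud_max_in nu : nu != [::] -> cloud_max nu \in nu.
Proof.
rewrite /cloud_max; case: nu => //= h nu _.
rewrite [X in X \in _]big_seq.
elim/big_ind : _ => //; first by rewrite mem_head.
by move=> x y xnu ynu; rewrite /Num.max; case: ifP.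
Qed.

Lemma diam_ge0 nu : nu != [::] -> 0 <= diam nu.
Proof. by move=> nu0; rewrite subr_ge0 cloud_min_le// cloud_max_in. Qed.

Lemma size_cloud_gt0 nu : nu != [::] -> 0 < (size nu)%:R :> R.
Proof. by case: nu => // *; rewrite ltr0n. Qed.

(** At [cloud_max nu + 1] no term exceeds [1], and at distance [1 / size nu]
    above the maximum the single term of the maximum already makes the mean at
    least [size nu]; the value [1] is attained in between. *)
Lemma cloud_b_exists nu : nu != [::] -> exists t, cloud_max nu < t /\
  1 = (size nu)%:R^-1 * \sum_(x <- nu) 1 / (t - x) ^+ 2.
Proof.
move=> nu0; have n0 := size_cloud_gt0 nu0.
set M := cloud_max nu; set n : R := (size nu)%:R in n0 *.
have n1 : 1 <= n by rewrite /n ler1n lt0n size_eq0.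
pose f t := n^-1 * \sum_(x <- nu) 1 / (t - x) ^+ 2.
have nV0 : 0 < n^-1 by rewrite invr_gt0.
have ab : M + n^-1 <= M + 1 by rewrite lerD2l invf_le1.
have fa : 1 <= f (M + n^-1).
  rewrite /f mulrC ler_pdivlMr// mul1r.
  (* Keep only the points equal to the maximum; there is at least one. *)
  have hM : (count (fun x => x == M) nu)%:R * n ^+ 2 <=
      \sum_(x <- nu) 1 / (M + n^-1 - x) ^+ 2.
    apply: count_mul_le_sum => [x _|_ _ /eqP ->].
      by rewrite divr_ge0// sqr_ge0.
    by rewrite addrAC subrr add0r exprVn div1r invrK.
  apply: le_trans hM; rewrite (@le_trans _ _ (1 * n ^+ 2))//.
    by rewrite mul1r expr2 ler_peMl// ltW.
  apply: ler_pM => //; first by rewrite sqr_ge0.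
  by rewrite ler1n -has_count has_pred1 cloud_max_in.
have fb : f (M + 1) <= 1.
  rewrite /f mulrC ler_pdivrMr// mul1r.
  rewrite /n -sum1_size natr_sum big_seq [leRHS]big_seq.
  apply: ler_sum => x /le_cloud_max; rewrite -/M => xM.
  have h : 1 <= (M + 1 - x) ^+ 2 by rewrite exprn_ege1//; lra.
  by rewrite div1r invf_le1// (lt_le_trans _ h).
have [c cI fc] : exists2 c, c \in `[M + n^-1, M + 1] & f c = 1.
  apply: IVT => //; last first.
    by rewrite ge_min le_max fa fb orbT.
  apply: continuous_in_subspaceT => t; rewrite inE/= in_itv/= => /andP[Mt _].
  apply: cvgM; first exact: cvg_cst.
  under eq_fun do rewrite big_seq.
  rewrite big_seq.
  apply: cvg_big => [|x xnu]; first exact: add_continuous.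
  under eq_fun do rewrite div1r.
  rewrite div1r.
  have := le_cloud_max xnu; rewrite -/M => xM.
  have tx : 0 < t - x by lra.
  apply: cvgV; first by rewrite expf_neq0// gt_eqF.
  under eq_fun do rewrite expr2.
  rewrite expr2.
  by apply: cvgM; apply: cvgB; [exact: cvg_id|exact: cvg_cst
    |exact: cvg_id|exact: cvg_cst].
exists c; split; last exact: esym fc.
by move: cI; rewrite in_itv/= => /andP[]; lra.
Qed.

Lemma cloud_b_gt_max nu : nu != [::] -> cloud_max nu < cloud_b nu.
Proof. by move=> /cloud_b_exists/getPex[]. Qed.

Lemma cloud_b_sum nu : nu != [::] ->
  \sum_(x <- nu) 1 / (cloud_b nu - x) ^+ 2 = (size nu)%:R.
Proof.
move=> nu0; have /getPex[_ h] := cloud_b_exists nu0.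
have n0 : (size nu)%:R != 0 :> R by rewrite gt_eqF// size_cloud_gt0.
by apply: (mulfI (invr_neq0 n0)); rewrite mulVf// [RHS]h.
Qed.

(** All the terms of the mean are bounded by that of the maximum, and the mean
    is [1], so that term is at least [1]. *)
Lemma cloud_b_sub_max_le1 nu : nu != [::] -> cloud_b nu - cloud_max nu <= 1.
Proof.
move=> nu0; have n0 := size_cloud_gt0 nu0.
have Mb := cloud_b_gt_max nu0.
have d0 : 0 < cloud_b nu - cloud_max nu by rewrite subr_gt0.
have : (size nu)%:R <= (size nu)%:R * (1 / (cloud_b nu - cloud_max nu) ^+ 2).
  rewrite -{1}cloud_b_sum// -sum1_size natr_sum mulr_suml.
  rewrite big_seq [leRHS]big_seq; apply: ler_sum => x /le_cloud_max xM.
  rewrite mul1r !div1r lef_pV2 ?posrE ?exprn_gt0//; last by lra.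
  by rewrite lerXn2r// ?nnegrE; lra.
rewrite ler_pMr// div1r invf_ge1 ?exprn_gt0// => h.
by rewrite -(@expr_le1 _ 2)// ltW.
Qed.

(** Markov's inequality for the points within [eta] of the maximum, whose gaps
    to [cloud_b nu] are at most [cloud_b nu - cloud_max nu + eta]. *)
Lemma sqrt_rho_sub_le nu eta : nu != [::] -> 0 <= eta ->
  Num.sqrt (rho nu eta) - eta <= cloud_b nu - cloud_max nu.
Proof.
move=> nu0 eta0; have n0 := size_cloud_gt0 nu0.
have Mb := cloud_b_gt_max nu0.
set c := cloud_b nu - cloud_max nu + eta.
have c0 : 0 < c by rewrite /c; lra.
rewrite lerBlDr -/c -[leRHS]ger0_norm ?(ltW c0)// -sqrtr_sqr.
apply: ler_wsqrtr; rewrite /rho ler_pdivrMr// mulrC -ler_pdivrMr ?exprn_gt0//.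
rewrite -[leRHS]cloud_b_sum//.
apply: count_mul_le_sum => x xnu; first by rewrite divr_ge0// sqr_ge0.
have xM := le_cloud_max xnu => etax.
rewrite div1r lef_pV2 ?posrE ?exprn_gt0//; last by lra.
by rewrite lerXn2r// ?nnegrE /c; lra.
Qed.

End Cloud.

Theorem proposition5p2 (R : realType) (nu : forall n : nat, n.-tuple R)
    (alpha beta : \bar R)
    (halpha : alpha = limn_einf (fun n : nat =>
       ereal_sup [set ((Num.sqrt (rho (nu n) eta) - eta) / 2)%:E
                 | eta in [set eta : R | 0 <= eta <= diam (nu n)]]))
    (hbeta : beta = (limn_esup (fun n : nat => (diam (nu n))%:E) + 2%:E)%E) :
  (0 < alpha)%E -> (beta < +oo)%E ->
  \forall n \near \oo, cloud_F alpha beta (nu n).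
Proof.
move=> alpha0 betay.
set S := (X in limn_einf X) in halpha.
have nu0 n : (0 < n)%N -> tval (nu n) != [::].
  by rewrite -size_eq0 size_tuple -lt0n.
have S_le n : (0 < n)%N ->
    (S n <= ((cloud_b (nu n) - cloud_max (nu n)) / 2)%:E)%E.
  move=> /nu0 n0; apply: ge_ereal_sup => _ [eta /andP[eta0 _] <-].
  by rewrite lee_fin ler_pM2r// sqrt_rho_sub_le.
have lower : \forall n \near \oo,
    (alpha <= (cloud_b (nu n) - cloud_max (nu n))%:E)%E.
  (* As [S n] is at most half the gap, [S n > alpha / 2] is enough; when
     [alpha = +oo], [S n > 1 / 2] would force a gap larger than [1]. *)
  case: alpha halpha alpha0 => [r hr|hr _|//].
  - rewrite lte_fin => r0.
    have : ((r / 2)%:E < limn_einf S)%E by rewrite -hr lte_fin; lra.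
    move=> /lt_limn_einf_near SN; near=> n.
    have : ((r / 2)%:E < S n)%E by near: n.
    have n0 : (0 < n)%N by near: n; exists 1%N.
    move=> /lt_le_trans/(_ (S_le _ n0)); rewrite lte_fin lee_fin.
    by rewrite ltr_pM2r// => /ltW.
  - have : ((1 / 2)%:E < limn_einf S)%E by rewrite -hr ltry.
    move=> /lt_limn_einf_near SN; near=> n.
    have : ((1 / 2)%:E < S n)%E by near: n.
    have n0 : (0 < n)%N by near: n; exists 1%N.
    move=> /lt_le_trans/(_ (S_le _ n0)); rewrite lte_fin ltr_pM2r//.
    by rewrite ltNge cloud_b_sub_max_le1// nu0.
have upper : \forall n \near \oo, ((diam (nu n) + 1)%:E <= beta)%E.
  (* A limsup equal to [-oo] is impossible since diameters are nonnegative. *)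
  move: hbeta betay; case E : limn_esup => [r| |] -> //= _; last first.
    have : (limn_esup (fun n => (diam (nu n))%:E) < 0)%E by rewrite E.
    move=> /limn_esup_lt_near dN; near=> n.
    have : ((diam (nu n))%:E < 0)%E by near: n.
    have n0 : (0 < n)%N by near: n; exists 1%N.
    by rewrite lte_fin ltNge diam_ge0// nu0.
  have : (limn_esup (fun n => (diam (nu n))%:E) < (r + 1)%:E)%E.
    by rewrite E lte_fin; lra.
  move=> /limn_esup_lt_near; apply: filterS => n.
  by rewrite lte_fin lee_fin; lra.
near=> n.
have n0 : (0 < n)%N by near: n; exists 1%N.
split=> [|x xnu]; first exact: nu0.
have xM := le_cloud_max xnu; have mx := cloud_min_le xnu.
have bM := cloud_b_sub_max_le1 (nu0 _ n0).
apply/andP; split.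
  have /le_trans -> // : (alpha <= (cloud_b (nu n) - cloud_max (nu n))%:E)%E.
    by near: n.
  by rewrite lee_fin; lra.
have /(le_trans _) -> // : ((diam (nu n) + 1)%:E <= beta)%E by near: n.
by rewrite lee_fin /diam; lra.
Unshelve. all: by end_near.
Qed.
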